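(* Let $f\in\mathbb{R}^q$ and let $W$ be a linear subspace of $\mathbb{R}^q$ such that $f+W$ contains a point of $\mathbb{Z}^q$. Then: (a) Every nontrivial valid linear inequality for $R_f(W)$ is dominated by a nontrivial minimal valid linear inequality for $R_f(W)$. (b) Every nontrivial minimal valid linear inequality for $R_f(W)$ is equivalent to an inequality of the form $\sum_{r\in W}\psi_B(r)s_r\geq 1$ such that $\psi_B(r)\geq 0$ for all $r\in W$ and $B$ is a maximal lattice-free convex set in $f+W$ with $f$ in its interior (relative to $f+W$).
   Context: Setting: $f\in\mathbb{R}^q$, $W\subseteq\mathbb{R}^q$ is a linear subspace, and $(f+W)\cap\mathbb{Z}^q\neq\emptyset$. $R_f(W)$ is the set of all $s=(s_r)_{r\in W}\in\mathbb{R}^W$ with finite support such that $s_r\ge 0$ for all $r\in W$ and $f+\sum_{r\in W} r s_r\in\mathbb{Z}^q$. $V$ is the affine hull of $(f+W)\cap\mathbb{Z}^q$. Fix $C\in\mathbb{R}^{\ell\times q}$ and $d\in\mathbb{R}^\ell$ with $V=\{x\in f+W : Cx=d\}$. $\mathcal{V}$ is the set of finitely supported $s\in\mathbb{R}^W$ with $f+\sum_{r\in W}rs_r\in V$. A linear inequality is $\sum_{r\in W}\psi(r)s_r\ge\alpha$ with $\psi:W\to\mathbb{R}$ and $\alpha\in\mathbb{R}$. - It is valid for $R_f(W)$ if every $s\in R_f(W)$ satisfies it. - It is trivial if it is satisfied by every $s\in\mathcal{V}$ with $s_r\ge0$ for all $r\in W$; otherwise it is nontrivial. - $\sum_{r}\psi(r)s_r\ge\alpha$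 dominates $\sum_r\psi'(r)s_r\ge\alpha$ (same right-hand side) if $\psi(r)\le\psi'(r)$ for all $r\in W$. - A valid inequality $\sum_{r}\psi(r)s_r\ge\alpha$ is minimal if it is not dominated by any valid inequality $\sum_{r}\psi'(r)s_r\ge\alpha$ with $\psi'\ne\psi$. - Two valid inequalities $\sum_r\psi(r)s_r\ge\alpha$ and $\sum_r\psi'(r)s_r\ge\alpha'$ are equivalent if there exist $\rho>0$ and $\lambda\in\mathbb{R}^\ell$ such that $\psi(r)=\rho\psi'(r)+\lambda^TCr$ for all $r\in W$ and $\alpha=\rho\alpha'+\lambda^T(d-Cf)$. A set $B$ is a maximal lattice-free convex set in $f+W$ if $B\subseteq f+W$, $B$ is convex, $B$ has no integral point in its interior relative to $f+W$, and $B$ is inclusionwise maximal with these properties. Such a $B$ with $f$ in its interior is known to be a polyhedron, so it can be written irredundantly (one inequality per facet) as $B=\{x\in f+W : a_i(x-f)\le 1,\ i=1,\dots,t\}$ with $a_1,\dots,a_t\in\mathbb{R}^q$; then $\psi_B:W\to\mathbb{R}$ is defined by $\psi_B(r)=\max_{i=1,\dots,t}a_ir$. *)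

(* Defs.v *)
From HB Require Import structures.
From mathcomp Require Import all_boot all_order all_algebra finmap.
From mathcomp Require Import all_classical all_reals all_analysis.

Set Implicit Arguments.
Unset Strict Implicit.
Unset Printing Implicit Defensive.

Import Order.TTheory GRing.Theory Num.Theory.
Import numFieldNormedType.Exports.

Local Open Scope classical_set_scope.
Local Open Scope ring_scope.

Section InfiniteRelaxation.
Context {R : realType} {q : nat}.
Implicit Types (f x : 'cV[R]_q) (W : {vspace 'cV[R]_q}) (A B : set 'cV[R]_q).

Definition integral_points : set 'cV[R]_q :=
  [set x | x \is a mxOver (@Num.int R)].

Definition translate f W : set 'cV[R]_q := [set x | x - f \in W].

Definition affine_hull A : set 'cV[R]_q :=
  [set x | exists n (c : 'I_n -> R) (p : 'I_n -> 'cV[R]_q),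
    [/\ forall i, A (p i), \sum_(i < n) c i = 1
      & x = \sum_(i < n) c i *: p i]].

Definition weights W := {fsfun subvs_of W -> R with 0}.

Definition weighted_point f W (s : weights W) : 'cV[R]_q :=
  f + \sum_(r <- finsupp s) s r *: vsval r.

Definition Rf f W : set (weights W) :=
  [set s : weights W |
    (forall r, 0 <= s r) /\ integral_points (weighted_point f s)].

Definition affV f W : set 'cV[R]_q :=
  affine_hull (translate f W `&` integral_points).

Definition calV f W : set (weights W) :=
  [set s : weights W | affV f W (weighted_point f s)].

(* A pair psi, alpha stands for the inequality "sum_r psi(r) s_r >= alpha". *)
Definition satisfies W (psi : subvs_of W -> R) (alpha : R) (s : weights W) :=
  alpha <= \sum_(r <- finsupp s) psi r * s r.

Definition valid f W (psi : subvs_of W -> R) (alpha : R) :=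
  forall s : weights W, Rf f s -> satisfies psi alpha s.

Definition trivial_ineq f W (psi : subvs_of W -> R) (alpha : R) :=
  forall s : weights W, calV f s -> (forall r, 0 <= s r) ->
    satisfies psi alpha s.

Definition nontrivial f W (psi : subvs_of W -> R) (alpha : R) :=
  ~ trivial_ineq f psi alpha.

(* Domination between inequalities with a common right-hand side. *)
Definition dominates W (psi psi' : subvs_of W -> R) :=
  forall r, psi r <= psi' r.

Definition minimal f W (psi : subvs_of W -> R) (alpha : R) :=
  valid f psi alpha /\
  ~ exists psi', [/\ valid f psi' alpha, psi' <> psi & dominates psi' psi].

Definition equivalent f W l (C : 'M[R]_(l, q)) (d : 'cV[R]_l)
    (psi : subvs_of W -> R) (alpha : R) (psi' : subvs_of W -> R) (alpha' : R) :=
  [/\ valid f psi alpha, valid f psi' alpha' &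
    exists (rho : R) (lambda : 'cV[R]_l),
      [/\ 0 < rho,
          forall r, psi r =
            rho * psi' r + (lambda^T *m C *m vsval r) ord0 ord0
        & alpha = rho * alpha' + (lambda^T *m (d - C *m f)) ord0 ord0]].

(* Interior of B relative to A, for B `<=` A only: in the library's topology
   on [subspace A] the points outside A are isolated. *)
Definition relint A B : set 'cV[R]_q := @interior (subspace A) B.

Definition lattice_free f W B :=
  [/\ B `<=` translate f W,
      convex_set (B : set (convex_lmodType 'cV[R]_q))
    & relint (translate f W) B `&` integral_points = set0].

Definition maximal_lattice_free f W B :=
  lattice_free f W B /\
  forall B', lattice_free f W B' -> B `<=` B' -> B' = B.

Definition polyhedron f W t (a : 'I_t -> 'rV[R]_q) (P : pred 'I_t) :
    set 'cV[R]_q :=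
  [set x | translate f W x /\
           forall i, P i -> (a i *m (x - f)) ord0 ord0 <= 1].

Definition irredundant_description f W t (a : 'I_t -> 'rV[R]_q) B :=
  B = polyhedron f W a predT /\
  forall i, polyhedron f W a (predC1 i) <> B.

(* The description is taken with t.+1 inequalities so that the maximum ranges
   over a nonempty set; a description of B with no inequality would mean
   B = f + W, which is not lattice-free when f + W has an integral point. *)
Definition psiB W t (a : 'I_t.+1 -> 'rV[R]_q) (r : subvs_of W) : R :=
  \big[Num.max/(a ord0 *m vsval r) ord0 ord0]_(i < t.+1)
    (a i *m vsval r) ord0 ord0.

End InfiniteRelaxation.

(* Main.v *)
(* The valid inequalities below a valid one are bounded below pointwise, by
   [alpha - psi (r0 - r)] at [r] when [f + r0] is integral, so Zorn's lemma
   gives minimal ones.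

   A minimal [psi] is sublinear.  It is nonnegative on the directions of the
   affine hull, so by Hahn-Banach a linear functional [lambda^T C] vanishing
   there lies below [psi]; subtracting it and rescaling gives a nonnegative
   minimal [phi] with right-hand side 1.  Every integral point [f + r] satisfies
   [phi r >= 1], hence, by Hahn-Banach again, [g r >= 1] for some linear
   [g <= phi].  By a parity argument of Doignon, [2 ^ q] such functionals
   suffice for the integral points of a box, and by Tychonoff's theorem [2 ^ q]
   of them suffice for all integral points at once.  Their maximum is valid and
   below [phi], so it equals [phi] by minimality: [{phi <= 1}] is a polyhedron,
   and it is maximal lattice-free because [phi] is minimal. *)
Require Import Defs.
From HB Require Import structures.
From mathcomp Require Import all_boot all_order all_algebra finmap.
From mathcomp Require Import all_classical all_reals all_analysis.
From mathcomp Require Import ring lra zify.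

Set Implicit Arguments.
Unset Strict Implicit.
Unset Printing Implicit Defensive.

Import Order.TTheory GRing.Theory Num.Theory.
Import numFieldNormedType.Exports.

Local Open Scope classical_set_scope.
Local Open Scope ring_scope.

(** * Sublinear functions and the Hahn-Banach theorem in finite dimension *)

Section HahnBanach.
Context {R : realType} {E : vectType R}.
Implicit Types (p : E -> R) (U : {vspace E}) (g h : 'Hom(E, R^o)).

Definition sublinear p :=
  (forall x y, p (x + y) <= p x + p y) /\
  (forall t x, 0 <= t -> p (t *: x) = t * p x).

Lemma sublinear_sum p (I : eqType) (s : seq I) (c : I -> R) (x : I -> E) :
  sublinear p -> (forall i, i \in s -> 0 <= c i) ->
  p (\sum_(i <- s) c i *: x i) <= \sum_(i <- s) p (x i) * c i.
Proof.
move=> [pD pZ]; elim: s => [|i s IHs] c0.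
  by rewrite !big_nil -(scale0r 0) pZ// mul0r.
rewrite !big_cons (le_trans (pD _ _))// lerD//.
  by rewrite pZ ?c0 ?mem_head// mulrC.
by apply: IHs => j js; rewrite c0// inE js orbT.
Qed.

(** The line of [v] meets [U] only in 0, so [h] can be the projection onto that line along [U],
    followed by the coordinate on [v]. *)
Lemma separating_functional U (v : E) : v \notin U ->
  exists h, (forall u, u \in U -> h u = 0) /\ h v = 1.
Proof.
move=> vU.
have v0 : v != 0 by apply: contraNneq vU => ->; rewrite mem0v.
have dis : (<[v]> :&: U = 0)%VS.
  apply/eqP; rewrite -subv0; apply/subvP => w; rewrite memv_cap memv0.
  case/andP => /vlineP[k ->].
  have [->|k0] := eqVneq k 0; first by rewrite scale0r.
  by rewrite rpredZeq (negPf k0) (negPf vU).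
pose h : 'Hom(E, R^o) := (linfun (coord [tuple v] ord0) \o daddv_pi <[v]> U)%VF.
exists h; split=> [u uU|]; rewrite comp_lfunE lfunE /=.
  have -> : daddv_pi <[v]> U u = 0; last by rewrite linear0.
  have := daddv_pi_add dis (subvP (addvSr <[v]> U) _ uU).
  rewrite (daddv_pi_id _ uU); last by rewrite capvC.
  by move/(canRL (addrK _)); rewrite subrr.
rewrite daddv_pi_id ?memv_line//.
have := @coord_free R E 1 [tuple v] ord0 ord0; rewrite eqxx /= => -> //.
by rewrite seq1_free.
Qed.

(** A value [c] at [v] is admissible when [g u' - p (u' - v) <= c <= p (u + v) - g u] for all [u],
    [u'] in [U]. Subadditivity puts every lower bound below every upper one, so the supremum of the
    lower bounds serves. *)
Lemma hahn_banach_step p U g (v : E) : sublinear p ->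
  (forall u, u \in U -> g u <= p u) ->
  exists g', (forall u, u \in U -> g' u = g u) /\
             (forall u, u \in (U + <[v]>)%VS -> g' u <= p u).
Proof.
move=> [pD pZ] gp; have [vU|vU] := boolP (v \in U).
  exists g; split=> // u.
  by move: vU; rewrite memvE => /addv_idPl ->; exact: gp.
have [h [hU hv]] := separating_functional vU.
pose S := [set g u - p (u - v) | u in [set` U]].
have key u u' : u \in U -> u' \in U -> g u' - p (u' - v) <= p (u + v) - g u.
  move=> uU u'U; rewrite lerBrDr addrAC lerBlDr addrC -linearD.
  rewrite (le_trans (gp _ (memvD uU u'U)))// (le_trans _ (pD _ _))//.
  by rewrite addrACA subrr addr0.
have S0 : S !=set0 by exists (g 0 - p (0 - v)); exists 0 => //=; rewrite mem0v.
have Sub u : u \in U -> ubound S (p (u + v) - g u).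
  by move=> uU _ [u' /= u'U <-]; exact: key.
have hS : has_sup S by split=> //; exists (p (0 + v) - g 0); apply/Sub/mem0v.
pose c := sup S; exists (g + (c - g v) *: h)%R; split=> [u uU|].
  by rewrite add_lfunE scale_lfunE hU// scaler0 addr0.
move=> w /memv_addP[u uU [_ /vlineP[t ->] ->]].
have -> : (g + (c - g v) *: h)%R (u + t *: v) = g u + t * c.
  rewrite add_lfunE scale_lfunE !linearD !linearZ /= hU// hv /GRing.scale/=.
  ring.
have cub u' : u' \in U -> c <= p (u' + v) - g u'.
  by move=> u'U; apply: ge_sup => //; exact: Sub.
have clb u' : u' \in U -> g u' - p (u' - v) <= c.
  by move=> u'U; apply: ub_le_sup; [case: hS|exists u'].
(* Positive homogeneity reduces a nonzero coefficient [t] to the coefficients -1 and 1, for which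
   [clb] and [cub] are the required bounds. *)
have [t0|t0|->] := ltgtP t 0.
- have nt0 : 0 < - t by rewrite oppr_gt0.
  have := clb ((- t)^-1 *: u) (memvZ _ uU).
  rewrite linearZ /= lerBlDr -subr_ge0 -(pmulr_rge0 _ nt0).
  have -> : u + t *: v = (- t) *: ((- t)^-1 *: u - v).
    by rewrite scalerBr scalerA mulfV ?gt_eqF// scale1r scaleNr opprK.
  rewrite (pZ _ _ (ltW _)) // /GRing.scale/=; set q := p _; move=> H.
  suff : - t * (c + q - (- t)^-1 * g u) = q * - t + - t * c - g u by lra.
  by field; rewrite lt_eqF.
- have := cub (t^-1 *: u) (memvZ _ uU).
  rewrite linearZ /= -subr_ge0 -(pmulr_rge0 _ t0).
  have -> : u + t *: v = t *: (t^-1 *: u + v).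
    by rewrite scalerDr scalerA mulfV ?gt_eqF// scale1r.
  rewrite (pZ _ _ (ltW _)) // /GRing.scale/=; set q := p _; move=> H.
  suff : t * (q - t^-1 * g u - c) = t * q - g u - t * c by lra.
  by field; rewrite gt_eqF.
- by rewrite mul0r scale0r !addr0 gp.
Qed.

(** In finite dimension, one-vector extensions along a basis suffice. *)
Lemma hahn_banach p U g : sublinear p -> (forall u, u \in U -> g u <= p u) ->
  exists g', (forall u, u \in U -> g' u = g u) /\ (forall x, g' x <= p x).
Proof.
move=> psub gp.
suff ext (s : seq E) : exists g', (forall u, u \in U -> g' u = g u) /\
    (forall u, u \in (U + span s)%VS -> g' u <= p u).
  have [g' [g'U g'p]] := ext (vbasis {:E}); exists g'; split=> // x.
  apply: g'p; apply: (subvP (addvSr U _)).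
  by rewrite (span_basis (vbasisP _)) memvf.
elim: s => [|v s [g' [g'U g'p]]].
  by exists g; split=> // u; rewrite span_nil addv0; exact: gp.
have [g'' [g''U g''p]] := hahn_banach_step v psub g'p.
exists g''; split=> [u uU|u].
  by rewrite g''U ?g'U//; apply: (subvP (addvSl _ _)).
by rewrite span_cons (addvC <[v]>%VS) addvA; exact: g''p.
Qed.

(** Extend [t *: v |-> t * p v] from the line of [v]. For negative [t] it lies below [p] because
    [0 = p 0 <= p (t *: v) + p (- t *: v)]. *)
Lemma hahn_banach_tangent p (v : E) : sublinear p ->
  exists g, g v = p v /\ (forall x, g x <= p x).
Proof.
move=> psub; have [pD pZ] := psub.
have p0 : p 0 = 0 by rewrite -(scale0r 0) pZ ?mul0r.
have [v0|v0] := eqVneq v 0.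
  have [|g [_ gp]] := @hahn_banach p 0%VS 0 psub.
    by move=> u; rewrite memv0 => /eqP ->; rewrite linear0 p0.
  by exists g; split=> //; rewrite v0 linear0 p0.
have v0' : v \notin 0%VS by rewrite memv0.
have [h [_ hv]] := separating_functional v0'.
have [|g [gv gp]] := @hahn_banach p <[v]>%VS (p v *: h) psub; last first.
  exists g; split=> //; rewrite gv ?memv_line// scale_lfunE hv.
  by rewrite /GRing.scale/= mulr1.
move=> _ /vlineP[t ->]; rewrite scale_lfunE linearZ /= hv /GRing.scale/= mulr1.
have [t0|t0] := leP 0 t; first by rewrite pZ// mulrC.
have := pD (t *: v) ((- t) *: v); rewrite -scalerDl subrr scale0r p0.
by rewrite [p (- t *: v)]pZ ?oppr_ge0; [lra|exact: ltW].
Qed.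

End HahnBanach.

(** * Covering a finite set by few level sets *)

Section ParityCover.
Context {R : realType} {T D : finType}.

(* Doignon's argument: take a cover by upper level sets of the [g i] of least
   total size.  Each member then attains its minimum at a point covered by no
   other member, and the midpoint of two such points of equal colour would be
   uncovered. *)
Lemma parity_cover (c : T -> D) (g : T -> T -> R) :
  (forall x, 1 <= g x x) ->
  (forall x y, c x = c y -> exists w, forall i, g i w = (g i x + g i y) / 2) ->
  exists A : {set T}, (#|A| <= #|D|)%N /\
    forall x, exists2 i, i \in A & 1 <= g i x.
Proof.
move=> g1 mid.
pose upper (i : T) (C : {set T}) :=
  [forall x in C, (1 <= g i x) && [forall y, (y \notin C) ==> (g i y < g i x)]].
pose cover (X : {set T} * {ffun T -> {set T}}) :=
  [forall x, exists i in X.1, x \in X.2 i] && [forall i, upper i (X.2 i)].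
(* The successor makes discarding an index lower the size even when its set is empty. *)
pose size (X : {set T} * {ffun T -> {set T}}) :=
  (\sum_(i in X.1) #|X.2 i|.+1)%N.
pose X0 : {set T} * {ffun T -> {set T}} :=
  ([set: T]%SET, [ffun i => [set x | 1 <= g i x]%SET]).
have cover0 : cover X0.
  apply/andP; split.
    by apply/forallP => x; apply/existsP; exists x; rewrite !inE ffunE inE g1.
  apply/forallP => i; apply/forall_inP => x; rewrite ffunE inE => gx.
  rewrite gx /=; apply/forallP => y; apply/implyP; rewrite inE -ltNge => gy.
  exact: lt_le_trans gx.
case: (arg_minnP size cover0) => -[A C] /andP[/= /forallP cov /forallP up] Xmin.
have upP i x y : x \in C i -> y \notin C i -> g i y < g i x.
  move=> xC yC; have /forall_inP/(_ _ xC)/andP[_ /forallP/(_ y)] := up i.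
  by rewrite yC.
have ge1 i x : x \in C i -> 1 <= g i x.
  by move=> xC; have /forall_inP/(_ _ xC)/andP[] := up i.
pose private i := [pred x | [forall j in A, (x \in C j) == (j == i)]].
have privE i j x : private i x -> j \in A -> (x \in C j) = (j == i).
  by move=> /forall_inP/(_ j) h /h /eqP.
have exz i : i \in A ->
    exists z, private i z /\ forall x, x \in C i -> g i z <= g i x.
  move=> iA.
  have [z0 pz0] : exists z, private i z.
    apply: contrapT => nz.
    have covA : cover (A :\ i, C).
      apply/andP; split; last exact/forallP.
      apply/forallP => x; have /existsP[k /andP[kA xk]] := cov x.
      have [ki|ki] := eqVneq k i; last first.
        by apply/existsP; exists k; rewrite !inE ki kA.
      apply: contrapT => /negP; rewrite negb_exists => /forallP xn.
      apply: nz; exists x; apply/forall_inP => j jA.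
      have := xn j; rewrite !inE jA.
      have [->|ji] /= := eqVneq j i; first by rewrite -{1}ki xk.
      by move=> /negPf ->.
    have := Xmin _ covA; rewrite /size /= (big_setD1 i)//= => h.
    by move: h; rewrite addSn ltnNge leq_addl.
  pose z := [arg min_(z < z0 | private i z) g i z]%O.
  have [pz zmin] : private i z /\ forall x, private i x -> g i z <= g i x.
    by rewrite /z; case: arg_minP.
  exists z; split=> // x xC; apply: contrapT => /negP; rewrite -ltNge => xz.
  (* Shrinking [C i] to the level of [z] keeps a cover: private points of [i] have values at least
     [g i z], and any other point has another member. It would be strictly smaller, since it loses
     [x]. *)
  pose C' :=
    [ffun j => if j == i then [set y in C i | g i z <= g i y]%SET else C j].
  have covC : cover (A, C').
    apply/andP; split; [apply/forallP => /= y|apply/forallP => /= j].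
      have /existsP[k /andP[kA yk]] := cov y.
      have [py|] := boolP (private i y).
        apply/existsP; exists i; rewrite iA ffunE eqxx inE (zmin _ py) andbT.
        by rewrite (privE _ _ _ py iA) eqxx.
      rewrite negb_forall => /existsP[j]; rewrite negb_imply => /andP[jA].
      have [->|ji] := eqVneq j i.
        rewrite eqb_id => yi; apply/existsP; exists k; rewrite kA ffunE ifN//.
        by apply: contraNneq yi => <-.
      rewrite eqbF_neg negbK => yj.
      by apply/existsP; exists j; rewrite jA ffunE ifN.
    rewrite ffunE; case: (eqVneq j i) => [->|//].
    apply/forall_inP => y; rewrite inE => /andP[yC zy]; rewrite ge1//=.
    apply/forallP => y'; apply/implyP; rewrite inE negb_and.
    case/orP => [|]; first exact: upP.
    by rewrite -ltNge => /lt_le_trans; apply.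
  have := Xmin _ covC; rewrite /size /= leqNgt => /negP; apply.
  rewrite (big_setD1 i)//= [ltnRHS](big_setD1 i)//= ffunE eqxx -addSn leq_add//.
    rewrite !ltnS; apply: proper_card; apply/properP; split.
      by apply/fintype.subsetP => y; rewrite inE => /andP[].
    by exists x; rewrite // inE xC -ltNge.
  by apply: leq_sum => j; rewrite !inE => /andP[/negPf ji _]; rewrite ffunE ji.
exists A; split; last first.
  move=> x; have /existsP[i /andP[iA xi]] := cov x.
  by exists i; last exact: ge1.
have zP i : exists z, i \in A ->
    private i z /\ forall x, x \in C i -> g i z <= g i x.
  by have [/exz[z hz]|_] := boolP (i \in A); [exists z|exists i].
have {zP} [z zP] := choice zP.
(* The bound on [A] follows once the colours of the points [z i] are pairwise distinct. *)
rewrite -(@card_in_imset _ _ (c \o z) A) ?max_card// => i j iA jA /= czz.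
apply: contrapT => /eqP ij; have [w wE] := mid _ _ czz.
have [pi mi] := zP i iA; have [pj mj] := zP j jA.
(* If [k] is [i] or [j], the midpoint lies below the minimum on [C k]; otherwise both ends lie
   outside [C k], hence strictly below [g k w], which is their average. *)
have /existsP[k /andP[kA wk]] := cov w.
have [ki|ki] := eqVneq k i.
  subst k; have zjC : z j \notin C i by rewrite (privE _ _ _ pj iA).
  have ziC : z i \in C i by rewrite (privE _ _ _ pi iA).
  have := upP _ _ _ ziC zjC; have := mi _ wk; rewrite wE; lra.
have [kj|kj] := eqVneq k j.
  subst k; have ziC : z i \notin C j.
    by rewrite (privE _ _ _ pi jA) eq_sym (negPf ij).
  have zjC : z j \in C j by rewrite (privE _ _ _ pj jA).
  have := upP _ _ _ zjC ziC; have := mj _ wk; rewrite wE; lra.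
have ziC : z i \notin C k by rewrite (privE _ _ _ pi kA).
have zjC : z j \notin C k by rewrite (privE _ _ _ pj kA).
have := upP _ _ _ wk ziC; have := upP _ _ _ wk zjC; rewrite wE; lra.
Qed.

End ParityCover.

(** * Finitely supported weights built from lists *)

Section FinitelySupported.
Context {R : realType} {K : choiceType}.
Implicit Type l : seq (K * R).

(** Coefficients of repeated keys are added, so a combination can be given as a list with
    repetitions. *)
Definition weights_of_seq l : {fsfun K -> R with 0} :=
  [fsfun k in seq_fset tt [seq p.1 | p <- l] => \sum_(p <- l | p.1 == k) p.2].

Lemma weights_of_seqE l k : weights_of_seq l k = \sum_(p <- l | p.1 == k) p.2.
Proof.
rewrite fsfun_fun; case: ifPn => //; rewrite seq_fsetE => kl.
rewrite big_seq_cond big1// => p /andP[pl /eqP pk]; case/negP: kl.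
by rewrite -pk map_f.
Qed.

Lemma sum_weights_of_seq (V : lmodType R) (v : K -> V) l :
  \sum_(r <- finsupp (weights_of_seq l)) weights_of_seq l r *: v r =
  \sum_(p <- l) p.2 *: v p.1.
Proof.
pose S := seq_fset tt [seq p.1 | p <- l].
have sub : (finsupp (weights_of_seq l) `<=` S)%fset by exact: finsupp_sub.
have inS p : p \in l -> p.1 \in S by move=> pl; rewrite seq_fsetE map_f.
rewrite (big_fset_incl _ sub) /=; last first.
  by move=> r _ /fsfun_dflt ->; rewrite scale0r.
under eq_bigr do rewrite weights_of_seqE scaler_suml.
rewrite (exchange_big_dep predT)//= [LHS]big_seq [RHS]big_seq.
apply: eq_bigr => p pl.
rewrite (eq_bigl (fun i => i == p.1)); last by move=> i; rewrite eq_sym.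
rewrite -big_filter filter_pred1_uniq ?big_seq1 ?fset_uniq//.
exact: inS.
Qed.

End FinitelySupported.

(** * Valid inequalities, existence of minimal ones and their sublinearity *)

Section ValidInequalities.
Context {R : realType} {q : nat} (f : 'cV[R]_q) (W : {vspace 'cV[R]_q}).
Local Notation E := (subvs_of W).
Implicit Types (psi : E -> R) (alpha : R) (r : E) (s : weights W)
  (l : seq (E * R)).

Definition integral_ray r := integral_points (f + vsval r).

Lemma weighted_pointE s :
  weighted_point f s = f + vsval (\sum_(r <- finsupp s) s r *: r).
Proof. by rewrite /weighted_point linear_sum. Qed.

(** Lists can be concatenated and substituted into without tracking supports, which the replacement
    arguments on combinations rely on. *)
Lemma validP psi alpha :
  valid f psi alpha <->
  (forall l, (forall p, p \in l -> 0 <= p.2) ->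
     integral_ray (\sum_(p <- l) p.2 *: p.1) ->
     alpha <= \sum_(p <- l) psi p.1 * p.2).
Proof.
split=> [vpsi l l0 Zl | vpsi s [s0 Zs]]; last first.
  pose l := [seq (r, s r) | r <- finsupp s].
  have := vpsi l; rewrite !big_map /=.
  apply; last by rewrite weighted_pointE in Zs.
  by move=> _ /mapP[r _ ->]; exact: s0.
pose s : weights W := weights_of_seq l.
have : satisfies psi alpha s.
  apply: vpsi; split=> [r|]; last first.
    by rewrite weighted_pointE (sum_weights_of_seq id).
  by rewrite weights_of_seqE big_seq_cond sumr_ge0// => p /andP[/l0].
rewrite /satisfies; under eq_bigr do rewrite mulrC.
rewrite (@sum_weights_of_seq _ _ R^o psi).
by under eq_bigr do rewrite /GRing.scale/= mulrC.
Qed.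

Lemma valid_integral_ray psi alpha r :
  valid f psi alpha -> integral_ray r -> alpha <= psi r.
Proof.
move=> /validP/(_ [:: (r, 1)]); rewrite !big_seq1 /= mulr1 scale1r; apply.
by move=> p; rewrite inE => /eqP ->.
Qed.

Lemma valid_lower_bound psi alpha r0 r :
  integral_ray r0 -> valid f psi alpha -> alpha - psi (r0 - r) <= psi r.
Proof.
move=> Zr0 /validP/(_ [:: (r, 1); (r0 - r, 1)]).
rewrite !big_cons !big_nil /= !mulr1 !scale1r !addr0 (addrC r) subrK.
rewrite lerBlDr; apply=> //.
by move=> p; rewrite !inE => /orP[] /eqP ->.
Qed.

Lemma exists_integral_ray : translate f W `&` integral_points !=set0 ->
  exists r, integral_ray r.
Proof.
move=> [x [xW Zx]]; exists (vsproj W (x - f)).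
by rewrite /integral_ray vsprojK// addrC subrK.
Qed.

(** A weight has finite support, so by totality of the chain a single member is close to the infimum
    at all points of the support at once. *)
Lemma inf_chain_valid (A : set (E -> R)) alpha (m : E -> R) : A !=set0 ->
  total_on A (@dominates _ _ W) ->
  (forall psi, A psi -> valid f psi alpha /\ forall r, m r <= psi r) ->
  valid f (fun r => inf [set psi r | psi in A]) alpha.
Proof.
move=> [psi0 A0] Atot Av; set g := fun r => _.
have hinf r : has_inf [set psi r | psi in A].
  split; first by exists (psi0 r), psi0.
  by exists (m r) => _ [psi Apsi <-]; have [_] := Av _ Apsi.
have gle psi r : A psi -> g r <= psi r.
  by move=> Apsi; apply: ge_inf; [case: (hinf r)|exists psi].
have approx (e : R) (l : seq E) : 0 < e ->
    exists2 psi, A psi & forall r, r \in l -> psi r <= g r + e.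
  move=> e0; elim: l => [|r l [psi Apsi psil]]; first by exists psi0.
  have [_ [phi Aphi <-] phir] := inf_adherent e0 (hinf r).
  case: (Atot _ _ Apsi Aphi) => dom.
    exists psi => // r'; rewrite inE => /orP[/eqP ->|/psil//].
    by rewrite (le_trans (dom r))// ltW.
  exists phi => // r'; rewrite inE => /orP[/eqP ->|/psil]; first exact: ltW.
  exact/le_trans/dom.
move=> s Rs; rewrite /satisfies.
have s0 r : 0 <= s r by case: Rs.
(* A pointwise error [e / (1 + N)] costs at most [e] in total; the added 1 keeps the denominator
   positive when [s] is zero. *)
set N := \sum_(r <- finsupp s) s r.
have N0 : 0 < 1 + N by rewrite ltr_pwDl// sumr_ge0.
apply/ler_addgt0Pr => e e0.
have [psi Apsi psis] := approx (e / (1 + N)) (finsupp s) (divr_gt0 e0 N0).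
have [/(_ s Rs) + _] := Av _ Apsi; move/le_trans; apply.
apply: (@le_trans _ _ (\sum_(r <- finsupp s) (g r + e / (1 + N)) * s r)).
  by rewrite big_seq [leRHS]big_seq ler_sum// => r rs; rewrite ler_wpM2r// psis.
under eq_bigr do rewrite mulrDl.
rewrite big_split /= lerD2l -mulr_sumr -/N mulrAC ler_pdivrMr//.
by rewrite ler_wpM2l ?ltW//; lra.
Qed.

Lemma minimal_below psi alpha r0 : integral_ray r0 -> valid f psi alpha ->
  exists psi', minimal f psi' alpha /\ dominates psi' psi.
Proof.
move=> Zr0 vpsi.
pose T := {psi' : E -> R | valid f psi' alpha /\ dominates psi' psi}.
(* The order is reversed, so that Zorn's maximal elements are the pointwise lowest inequalities. *)
pose le (s t : T) := `[< dominates (sval t) (sval s) >].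
pose t0 : T := exist _ psi (conj vpsi (fun r => lexx (psi r))).
have [|||t tmax] := @ZL_preorder T t0 le.
- by move=> t; apply/asboolP => r.
- move=> r s t /asboolP rs /asboolP st; apply/asboolP => x.
  exact: le_trans (st x) (rs x).
- move=> A Atot; have [[s As]|A0] := pselect (A !=set0); last first.
    by exists t0 => s As; case: A0; exists s.
  pose A' := [set sval t | t in A].
  (* The bound uses [psi], which lies above every member, and is thus uniform over the chain. *)
  have lbA phi : A' phi ->
      valid f phi alpha /\ forall r, alpha - psi (r0 - r) <= phi r.
    case=> -[phi' [vphi dphi]] At /= <-; split=> // r.
    by rewrite (le_trans _ (valid_lower_bound r Zr0 vphi))// lerB// dphi.
  have vinf := @inf_chain_valid A' alpha (fun r => alpha - psi (r0 - r)).
  set g := fun r => inf _ in vinf.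
  have gle t r : A t -> g r <= sval t r.
    move=> At; apply: ge_inf; last by exists (sval t) => //; exists t.
    by exists (alpha - psi (r0 - r)) => _ [phi /lbA[_ +] <-]; exact.
  have vg : valid f g alpha.
    apply: vinf => //; first by exists (sval s), s.
    move=> _ _ [t At <-] [u Au <-].
    by case: (Atot _ _ At Au) => /asboolP h; [right|left].
  have dg : dominates g psi.
    by move=> r; rewrite (le_trans (gle _ _ As))//; case: (svalP s) => _; exact.
  by exists (exist _ g (conj vg dg)) => t At; apply/asboolP => r; exact: gle.
exists (sval t); case: t tmax => phi [vphi dphi] /= tmax.
split=> //; split=> //.
move=> [phi' [vphi' neq dphi']]; apply: neq.
have dpsi : dominates phi' psi by move=> r; exact: le_trans (dphi' r) (dphi r).
have /asboolP /= :=
  tmax (exist _ phi' (conj vphi' dpsi)) (introT (asboolP _) dphi').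
by move=> dom; apply/funext => r; apply/le_anti; rewrite dphi' dom.
Qed.

Lemma nontrivial_dominates psi psi' alpha : dominates psi' psi ->
  nontrivial f psi alpha -> nontrivial f psi' alpha.
Proof.
move=> dom; apply: contra_not => triv s Vs s0; apply: le_trans (triv s Vs s0) _.
by apply: ler_sum => r _; rewrite ler_wpM2r.
Qed.

(* Lowering [psi] at the single point [r0] keeps it valid: each occurrence of
   [r0] in a combination can be replaced by the multiset [l] summing to it. *)
Lemma minimal_combination psi alpha l : minimal f psi alpha ->
  (forall p, p \in l -> 0 <= p.2) ->
  psi (\sum_(p <- l) p.2 *: p.1) <= \sum_(p <- l) psi p.1 * p.2.
Proof.
move=> [vpsi nomin] l0; rewrite leNgt; apply/negP => lt.
set r0 := \sum_(p <- l) p.2 *: p.1 in lt; set b := \sum_(p <- l) _ in lt.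
apply: nomin; exists (fun r => if r == r0 then b else psi r); split; last first.
- by move=> r; case: eqVneq => [->|//]; exact: ltW.
- by move/(congr1 (@^~ r0)); rewrite eqxx => eqb; rewrite eqb ltxx in lt.
apply/validP => l' l'0 Zl'.
pose subst (p : E * R) :=
  if p.1 == r0 then [seq (p'.1, p.2 * p'.2) | p' <- l] else [:: p].
have substE p : \sum_(p' <- subst p) p'.2 *: p'.1 = p.2 *: p.1.
  rewrite /subst; case: eqVneq => [->|_]; last by rewrite big_seq1.
  by rewrite big_map scaler_sumr; apply: eq_bigr => p' _; rewrite scalerA.
have substF p : \sum_(p' <- subst p) psi p'.1 * p'.2 =
    (if p.1 == r0 then b else psi p.1) * p.2.
  rewrite /subst; case: eqVneq => [_|_]; last by rewrite big_seq1.
  by rewrite big_map mulr_suml; apply: eq_bigr => p' _; rewrite mulrCA mulrC.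
move/validP: vpsi => /(_ (flatten [seq subst p | p <- l'])).
rewrite !big_flatten !big_map /=.
under [in X in _ -> X -> _]eq_bigr do rewrite substE.
under [in X in _ -> _ -> X]eq_bigr do rewrite substF.
apply=> // p /flattenP[_ /mapP[p' p'l' ->]]; rewrite /subst.
case: ifP => _; last by rewrite inE => /eqP ->; exact: l'0.
by move=> /mapP[p'' p''l ->] /=; apply: mulr_ge0; [exact: l'0|exact: l0].
Qed.

(** Lists of length two and one give subadditivity and [psi (t *: x) <= t * psi x]. For positive [t]
    the converse is this bound for the inverse of [t]; at 0, [psi 0 <= psi 0 + psi 0] gives the
    missing sign. *)
Lemma minimal_sublinear psi alpha : minimal f psi alpha -> sublinear psi.
Proof.
move=> mpsi.
have psiD x y : psi (x + y) <= psi x + psi y.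
  have := @minimal_combination psi alpha [:: (x, 1); (y, 1)] mpsi.
  rewrite !big_cons !big_nil /= !scale1r !mulr1 !addr0; apply.
  by move=> p; rewrite !inE => /orP[] /eqP ->.
have psiZ t x : 0 <= t -> psi (t *: x) <= t * psi x.
  move=> t0; have := @minimal_combination psi alpha [:: (x, t)] mpsi.
  rewrite !big_seq1 /= mulrC; apply.
  by move=> p; rewrite !inE => /eqP ->.
split=> // t x; rewrite le_eqVlt => /predU1P[<-|t0]; last first.
  apply/le_anti; rewrite (psiZ _ _ (ltW t0)) /= -ler_pdivlMl//.
  by rewrite -[in leLHS](scalerK (lt0r_neq0 t0) x) psiZ// invr_ge0 ltW.
rewrite scale0r mul0r; apply/le_anti; apply/andP; split.
  by rewrite -(scale0r 0) (le_trans (psiZ _ _ _))// mul0r.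
by have := psiD 0 0; rewrite addr0; lra.
Qed.

Lemma sublinear_valid (p : E -> R) alpha : sublinear p ->
  (forall r, integral_ray r -> alpha <= p r) -> valid f p alpha.
Proof.
move=> psub Zp; apply/validP => l l0 Zl.
exact: le_trans (Zp _ Zl) (sublinear_sum (c := snd) fst psub l0).
Qed.

End ValidInequalities.

(** * Limits of finite families of functionals below a given function *)

Section FunctionalLimit.
Context {R : realType} {E : vectType R} {D : finType}.
Variable p : E -> R.

(** By linearity all values at [x] lie in the segment from [- p (- x)] to [p x]. The families thus
    live in a compact product, and a limit along an ultrafilter is again linear and below [p]. *)
Lemma functional_limit (S : nat -> set E) :
  (forall n, exists G : D -> 'Hom(E, R^o),
     (forall d x, G d x <= p x) /\ (forall r, S n r -> exists d, 1 <= G d r)) ->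
  exists G : D -> 'Hom(E, R^o), (forall d x, G d x <= p x) /\
     (forall r, (\forall n \near \oo, S n r) -> exists d, 1 <= G d r).
Proof.
move=> /choice[G GP].
pose X := prod_topology (fun _ : D * E => R).
pose u (n : nat) : X := fun i => G n i.1 i.2.
pose K := [set g : X | forall i, `[- p (- i.2), p i.2]%classic (g i)].
have cK : compact K.
  apply: (@tychonoff _ (fun _ : D * E => R)
    (fun i => `[- p (- i.2), p i.2]%classic)) => i.
  exact: segment_compact.
have uK n : K (u n).
  move=> [d x] /=; rewrite in_itv /=; have [Gp _] := GP n.
  by rewrite Gp andbT lerNl -linearN Gp.
have [F [UF uF]] := @ultraFilterLemma X (u @ \oo) _.
have FK : F K by apply: uF; exists 0 => // n _; exact: uK.
move: cK; rewrite compact_ultra => /(_ F UF FK)[v [Kv Fv]].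
have FP : ProperFilter F by exact: ultra_proper.
have Fev i : g i @[g --> F] --> v i.
  apply: cvg_trans (@proj_continuous _ (fun _ : D * E => R) i v).
  exact: cvg_app.
have vlin d : linear (fun x => v (d, x) : R^o).
  move=> a x y.
  have rhs : a * g (d, x) + g (d, y) @[g --> F] --> a * v (d, x) + v (d, y).
    exact: (@cvgD _ _ _ F _ _ _ _ _
      (@cvgMl_tmp _ _ F _ _ a _ (Fev (d, x))) (Fev (d, y))).
  apply: (norm_cvg_unique (Fev (d, a *: x + y))); apply: cvg_trans rhs.
  apply: near_eq_cvg; apply: uF; exists 0 => // n _ /=.
  by rewrite /u /= linearP.
pose L d : {linear E -> R^o} :=
  HB.pack (fun x => v (d, x) : R^o)
    (GRing.isLinear.Build R E R^o *:%R _ (vlin d)).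
exists (fun d => linfun (L d)); split=> [d x|r Sr].
  by rewrite lfunE /=; have := Kv (d, x); rewrite /= in_itv /= => /andP[].
(* Being below 1 at [r] is an open condition and [D] is finite, so if all limits were below 1, some
   family covering [r] would be too. *)
apply: contrapT => /forallNP small.
have Fsmall : \forall g \near F, forall d, g (d, r) < 1.
  apply: filter_forall => d; apply: (cvgr_lt _ (Fev (d, r))).
  by have /negP := small d; rewrite lfunE /= -ltNge.
have Flarge : \forall g \near F, exists d, 1 <= g (d, r).
  suff : \forall n \near \oo, exists d, 1 <= u n (d, r) by exact: uF.
  by apply: filterS Sr => n; have [_] := GP n; exact.
have [g [/= gs [d]]] := @filter_ex X F FP _ (filterI Fsmall Flarge).
by rewrite leNgt gs.
Qed.

End FunctionalLimit.

(** * Covering the integral points by [2 ^ q] functionals *)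

Section BoxCover.
Context {R : realType} {q : nat} (f : 'cV[R]_q) (W : {vspace 'cV[R]_q}).
Local Notation E := (subvs_of W).
Local Notation D := {ffun 'I_q -> bool}.

(** [parity_cover] is applied to functionals tangent to [p] at the integral points of the box,
    coloured by coordinate parities: the midpoint of two points of one colour is an integral point
    of the box in [f + W]. *)
Lemma box_cover (p : E -> R) (n : nat) : sublinear p ->
  (forall r, integral_ray f r -> 1 <= p r) ->
  exists G : D -> 'Hom(E, R^o), (forall d x, G d x <= p x) /\
    (forall r,
       integral_ray f r /\ (forall i, `|(f + vsval r) i ord0| <= n%:R) ->
       exists d, 1 <= G d r).
Proof.
move=> psub p1.
have half_double (v : 'cV[R]_q) : 2^-1 *: (v + v) = v.
  by rewrite scalerDr -scalerDl (_ : 2^-1 + 2^-1 = 1) ?scale1r//; field.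
(* Coordinates between [-n] and [n] are stored shifted by [n], which does not affect whether two of
   them have equal parity. *)
pose U := {ffun 'I_q -> 'I_(n + n).+1}.
pose pt (u : U) : 'cV[R]_q := \col_i ((u i)%:R - n%:R).
have ptZ u : integral_points (pt u).
  by apply/mxOverP => i j; rewrite mxE rpredB// rpred_nat.
pose T := {u : U | pt u - f \in W}.
pose ray (x : T) : E := vsproj W (pt (val x) - f).
have rayE x : f + vsval (ray x) = pt (val x).
  by rewrite vsprojK ?(valP x)// addrC subrK.
have [h hP] := choice (fun x : T => hahn_banach_tangent (ray x) psub).
have [h0 [_ h0p]] := hahn_banach_tangent 0 psub.
have h1 x : 1 <= h x (ray x).
  by have [-> _] := hP x; apply: p1; rewrite /integral_ray rayE.
have [|A [AD Acov]] := @parity_cover R T D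
    (fun x => [ffun i => odd (val x i)]) (fun i x => h i (ray x)) h1.
  move=> x y /ffunP cxy.
  pose w : U := [ffun i => inord ((val x i + val y i)./2)].
  have ptw : pt w = 2^-1 *: (pt (val x) + pt (val y)).
    apply/colP => i; rewrite !mxE !ffunE inordK; last first.
      by have := ltn_ord (val x i); have := ltn_ord (val y i); lia.
    have := cxy i; rewrite !ffunE => oxy.
    have := odd_double_half (val x i + val y i).
    rewrite oddD oxy addbb add0n -muln2 => /(congr1 (fun m => m%:R : R)).
    by rewrite natrM natrD; lra.
  have wW : pt w - f \in W.
    have -> : pt w - f = 2^-1 *: ((pt (val x) - f) + (pt (val y) - f)).
      by rewrite ptw addrACA -opprD scalerBr half_double.
    by apply: memvZ; apply: memvD; [exact: (valP x)|exact: (valP y)].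
  exists (exist _ w wW) => i.
  have -> : ray (exist _ w wW) = 2^-1 *: (ray x + ray y).
    rewrite /ray /= -linearD -linearZ; congr (vsproj W _).
    by rewrite ptw addrACA -opprD [RHS]scalerBr half_double.
  by rewrite /= linearZ linearD /= mulrC.
(* [A] may have fewer members than [D]; the surplus indices receive [h0], which is also below
   [p]. *)
pose G (d : D) := nth h0 [seq h i | i <- enum A] (enum_rank d).
exists G; split=> [d x|r [Zr box]].
  rewrite /G; have [lt|ge] := ltnP (enum_rank d) (size [seq h i | i <- enum A]).
    have /mapP[i _ ->] := mem_nth h0 lt.
    by have [_] := hP i.
  by rewrite nth_default.
have /choice[m mE] : forall i, exists m : int, (f + vsval r) i ord0 = m%:~R.
  by move=> i; apply/intrP; move/mxOverP: Zr => /(_ i ord0).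
have mB i : (- (n%:Z) <= m i <= n%:Z).
  have := box i; rewrite ler_norml mE => /andP[lo hi]; apply/andP.
  by rewrite -!(ler_int R) rmorphN.
pose u : U := [ffun i => inord (absz (m i + n%:Z)%R)].
have ptu : pt u = f + vsval r.
  apply/colP => i; rewrite mE mxE ffunE inordK; last first.
    by rewrite -ltz_nat gez0_abs; have := mB i; lia.
  by rewrite natr_absz ger0_norm; [rewrite rmorphD addrK|have := mB i; lia].
have uW : pt u - f \in W by rewrite ptu addrC addKr subvsP.
have [i iA hi] := Acov (exist _ u uW).
have rE : ray (exist _ u uW) = r.
  by rewrite /ray /= ptu addrC addKr vsvalK.
have idx : (index i (enum A) < #|D|)%N.
  by rewrite (leq_trans _ AD)// cardE index_mem mem_enum.
exists (enum_val (Ordinal idx)).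
rewrite /G enum_valK /= (nth_map i) ?index_mem ?mem_enum//.
rewrite nth_index ?mem_enum//.
by rewrite -rE.
Qed.

Lemma integral_cover (p : E -> R) : sublinear p ->
  (forall r, integral_ray f r -> 1 <= p r) ->
  exists G : D -> 'Hom(E, R^o), (forall d x, G d x <= p x) /\
    (forall r, integral_ray f r -> exists d, 1 <= G d r).
Proof.
move=> psub p1.
have [G [Gp Gcov]] := functional_limit (fun n => box_cover n psub p1).
exists G; split=> // r Zr; apply: Gcov.
pose B := \sum_i `|(f + vsval r) i ord0|.
exists (Num.trunc B).+1 => // n /= nB; split=> // i.
apply: (@le_trans _ _ B).
  by rewrite /B (bigD1 i)//= lerDl sumr_ge0.
by rewrite (le_trans (ltW (truncnS_gt _)))// ler_nat.
Qed.

End BoxCover.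

(** * Functionals as row vectors, and normalization to right-hand side 1 *)

Lemma linear_colE (R : realType) (q : nat) (V : lmodType R)
    (h : {linear 'cV[R]_q -> V}) (x : 'cV[R]_q) :
  h x = \sum_j x j ord0 *: h (delta_mx j ord0).
Proof.
rewrite [in LHS](matrix_sum_delta x) linear_sum; apply: eq_bigr => j _.
by rewrite big_ord1 linearZ.
Qed.

Section Normalization.
Context {R : realType} {q : nat} (f : 'cV[R]_q) (W : {vspace 'cV[R]_q}).
Local Notation E := (subvs_of W).
Implicit Types (psi : E -> R) (alpha : R) (r : E) (s : weights W)
  (h : 'Hom(E, R^o)).

Definition functional_row h : 'rV[R]_q := \row_j h (vsproj W (delta_mx j ord0)).

Lemma functional_rowE h (x : 'cV[R]_q) :
  (functional_row h *m x) ord0 ord0 = h (vsproj W x).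
Proof.
rewrite [in RHS](linear_colE (vsproj W)) linear_sum mxE; apply: eq_bigr => j _.
by rewrite mxE linearZ mulrC.
Qed.

Lemma functional_row_vsval h r : (functional_row h *m vsval r) ord0 ord0 = h r.
Proof. by rewrite functional_rowE vsvalK. Qed.

(** With [P] the matrix of the projection onto [W], the columns of the cokernel of [C *m P] project
    into the kernel of [C], where [h] vanishes. Hence the row of [h] lies in the row space of
    [C *m P]. *)
Lemma kernel_functional l (C : 'M[R]_(l, q)) h :
  (forall r, C *m vsval r = 0 -> h r = 0) ->
  exists lambda : 'cV[R]_l,
    forall r, h r = (lambda^T *m C *m vsval r) ord0 ord0.
Proof.
move=> hC.
pose P : 'M[R]_q := \matrix_(i, j) vsval (vsproj W (delta_mx j ord0)) i ord0.
have PE x : P *m x = vsval (vsproj W x).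
  rewrite [in RHS](linear_colE (vsproj W)) linear_sum.
  apply/colP => i; rewrite mxE summxE; apply: eq_bigr => j _.
  by rewrite linearZ !mxE mulrC.
have : (functional_row h <= C *m P)%MS.
  rewrite submxE; apply/eqP/rowP => j.
  have := hC (vsproj W (cokermx (C *m P) *m delta_mx j ord0)).
  rewrite -PE mulmxA mulmxA mulmx_coker mul0mx => /(_ erefl).
  by rewrite -functional_rowE mulmxA -colE !mxE.
case/submxP => X hX; exists X^T => r.
by rewrite trmxK -functional_row_vsval hX -!mulmxA PE vsvalK.
Qed.

Lemma valid_affine psi beta (rho c : R) h : 0 <= rho ->
  (forall r, integral_ray f r -> h r = c) -> valid f psi beta ->
  valid f (fun r => rho * psi r + h r) (rho * beta + c).
Proof.
move=> rho0 hc vpsi s Rs; rewrite /satisfies.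
have [s0 Zs] := Rs; rewrite weighted_pointE in Zs.
under eq_bigr do rewrite mulrDl -mulrA.
rewrite big_split /= -mulr_sumr lerD ?ler_wpM2l//; first exact: vpsi.
rewrite -(hc _ Zs) linear_sum /=; apply: ler_sum => r _.
by rewrite linearZ mulrC.
Qed.

(** The map [psi' |-> rho * psi' + h] and its inverse preserve validity and the pointwise order,
    since [h] contributes exactly [c] on [Rf]. *)
Lemma minimal_affine psi alpha (rho c : R) h : 0 < rho ->
  (forall r, integral_ray f r -> h r = c) -> minimal f psi (rho * alpha + c) ->
  minimal f (fun r => rho^-1 * (psi r - h r)) alpha.
Proof.
move=> rho0 hc [vpsi nomin]; have rhoN0 := lt0r_neq0 rho0; split.
  have hc' r : integral_ray f r -> (- rho^-1 *: h)%R r = - rho^-1 * c.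
    by move=> Zr; rewrite scale_lfunE (hc _ Zr).
  have := @valid_affine _ _ rho^-1 _ _ (ltW _) hc' vpsi.
  rewrite invr_gt0 => /(_ rho0); congr valid; last by field.
  by apply/funext => r; rewrite scale_lfunE /GRing.scale/=; ring.
move=> [psi' [vpsi' neq dom]]; apply: nomin.
exists (fun r => rho * psi' r + h r); split.
- by apply: valid_affine => //; exact: ltW.
- move=> eq; apply: neq; apply/funext => r.
  by rewrite -eq addrK mulKf.
- move=> r; have := dom r.
  by rewrite -(ler_pM2l rho0) mulVKf// lerBrDr.
Qed.

(* Rounding [N c_i] down gives integral translates of [r0]; the fractional parts
   contribute a term bounded independently of [N]. *)
Lemma integral_span_ge0 psi alpha r0 n (v : 'I_n -> E) (c : 'I_n -> R) :
  sublinear psi -> valid f psi alpha -> integral_ray f r0 ->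
  (forall i, integral_points (vsval (v i))) ->
  0 <= psi (\sum_i c i *: v i).
Proof.
move=> psub vpsi Zr0 Zv; have [pD pZ] := psub; set r := \sum_i _.
pose K := psi r0 + \sum_i `|psi (- v i)|.
have bound (N : nat) : alpha <= K + N%:R * psi r.
  pose k i := Num.floor (N%:R * c i).
  have frac i : 0 <= N%:R * c i - (k i)%:~R <= 1.
    have /andP[lo hi] := floor_itv (N%:R * c i).
    by rewrite subr_ge0 lo lerBlDr -(intrD _ 1%:Z) addrC ltW.
  pose z := r0 + \sum_i (k i)%:~R *: v i.
  have Zz : integral_ray f z.
    rewrite /integral_ray /z linearD addrA linear_sum; apply/mxOverP => i j.
    rewrite mxE rpredD//; first by move/mxOverP: Zr0; exact.
    rewrite summxE rpred_sum// => m _; rewrite linearZ mxE rpredM//.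
      exact: intr_int.
    by move/mxOverP: (Zv m); exact.
  have zE : z = (r0 + N%:R *: r) + \sum_i (N%:R * c i - (k i)%:~R) *: - v i.
    rewrite /z -addrA; congr (_ + _); rewrite /r scaler_sumr -big_split /=.
    apply: eq_bigr => i _; rewrite scalerN -scaleNr scalerA -scalerDl.
    by congr (_ *: _); ring.
  apply: (le_trans (valid_integral_ray vpsi Zz)); rewrite zE.
  apply: (le_trans (pD _ _)); rewrite /K [leRHS]addrAC lerD//.
    by rewrite (le_trans (pD _ _))// pZ.
  apply: le_trans (sublinear_sum _ psub _) _ => [i _|].
    by case/andP: (frac i).
  apply: ler_sum => i _; have /andP[f0 f1] := frac i.
  rewrite (le_trans (ler_norm _))// normrM (ger0_norm f0).
  by rewrite ler_piMr.
rewrite leNgt; apply/negP => r0lt.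
(* For a negative [psi r], this [N] is large enough to push [K + N * psi r] below [alpha]. *)
have := bound (Num.trunc ((K - alpha) / - psi r)).+1.
apply/negP; rewrite -ltNge.
have := truncnS_gt ((K - alpha) / - psi r).
by rewrite ltr_pdivrMr ?oppr_gt0//; set N := _%:R; lra.
Qed.

Lemma affV_integral r : integral_ray f r -> affV f W (f + vsval r).
Proof.
move=> Zr; exists 1%N, (fun=> 1), (fun=> f + vsval r); split.
- by move=> _; split=> //; rewrite /translate /= addrC addKr subvsP.
- by rewrite big_ord1.
- by rewrite big_ord1 scale1r.
Qed.

Lemma normalize l (C : 'M[R]_(l, q)) (d : 'cV[R]_l) psi alpha r0 :
  affV f W = [set x | translate f W x /\ C *m x = d] ->
  integral_ray f r0 -> minimal f psi alpha -> nontrivial f psi alpha ->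
  exists (phi : E -> R) (rho : R) (lambda : 'cV[R]_l),
    [/\ minimal f phi 1, (forall r, 0 <= phi r), 0 < rho,
        forall r, psi r = rho * phi r + (lambda^T *m C *m vsval r) ord0 ord0
      & alpha = rho * 1 + (lambda^T *m (d - C *m f)) ord0 ord0].
Proof.
move=> VE Zr0 mpsi ntriv.
have psub := minimal_sublinear mpsi; have [vpsi _] := mpsi.
have Vd r : affV f W (f + vsval r) -> C *m vsval r = d - C *m f.
  by rewrite VE => -[_ <-]; rewrite mulmxDr addrC addKr.
have Zd r : integral_ray f r -> C *m vsval r = d - C *m f.
  by move/affV_integral; exact: Vd.
(* Here [f + r0 + r] lies in the affine hull; subtracting [f + r0] from an affine combination of
   integral points writes [r] as a real combination of integral vectors. *)
have psiL r : C *m vsval r = 0 -> 0 <= psi r.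
  move=> Cr; have : affV f W (f + vsval (r0 + r)).
    rewrite VE; split.
      by change (f + vsval (r0 + r) - f \in W); rewrite addrC addKr subvsP.
    rewrite (_ : vsval (r0 + r) = vsval r0 + vsval r)// !mulmxDr Cr (Zd _ Zr0).
    by rewrite addr0 addrC subrK.
  case=> n [c [p [pV c1 rE]]].
  pose v i := vsproj W (p i - (f + vsval r0)).
  have vE i : vsval (v i) = p i - (f + vsval r0).
    have [pW _] := pV i.
    by rewrite vsprojK// opprD addrA; apply: rpredB; [exact: pW|exact: subvsP].
  have -> : r = \sum_i c i *: v i.
    apply: val_inj; rewrite /= linear_sum /=.
    under eq_bigr do rewrite vE scalerBr.
    rewrite sumrB -rE -scaler_suml c1 scale1r.
    rewrite (_ : vsval (r0 + r) = vsval r0 + vsval r)// (addrA f).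
    by rewrite (addrC (f + _)) addrK.
  apply: (integral_span_ge0 _ psub vpsi Zr0) => i; rewrite vE.
  apply/mxOverP => a b.
  have [_ /mxOverP Zp] := pV i; rewrite mxE [X in _ + X]mxE rpredB//.
  by move/mxOverP: Zr0; exact.
pose CW : 'Hom(E, 'cV[R]_l) := linfun (mulmx C \o vsval).
have [|h [hL hpsi]] := @hahn_banach _ _ psi (lker CW) 0 psub.
  move=> r; rewrite memv_ker lfunE /= => /eqP Cr; rewrite zero_lfunE.
  exact: psiL.
have [|lambda lE] := @kernel_functional _ C h.
  by move=> r Cr; rewrite hL ?zero_lfunE// memv_ker lfunE /= Cr.
pose c := (lambda^T *m (d - C *m f)) ord0 ord0.
have hV r : affV f W (f + vsval r) -> h r = c.
  by move=> /Vd dE; rewrite lE -mulmxA dE.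
have hc r : integral_ray f r -> h r = c by move=> /affV_integral /hV.
(* Since [h] lies below [psi] and sums to [c] on [calV], [alpha <= c] would make the inequality
   trivial. *)
have rho0 : 0 < alpha - c.
  rewrite ltNge; apply/negP => le; apply: ntriv => s Vs s0.
  rewrite /satisfies; rewrite /calV /= weighted_pointE in Vs.
  rewrite subr_le0 in le; apply: (le_trans le); rewrite -(hV _ Vs) linear_sum.
  apply: ler_sum => r _; rewrite linearZ [leRHS]mulrC.
  by apply: ler_wpM2l; [exact: s0|exact: hpsi].
exists (fun r => (alpha - c)^-1 * (psi r - h r)), (alpha - c), lambda.
split=> //.
- by apply: (minimal_affine rho0 hc); rewrite mulr1 subrK.
- by move=> r; rewrite mulr_ge0 ?subr_ge0// invr_ge0 ltW.
- by move=> r; rewrite -lE mulVKf ?subrK// gt_eqF.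
- by rewrite mulr1 subrK.
Qed.

End Normalization.

(** * Relative interiors, and covers with the fewest functionals *)

Section RelativeInterior.
Context {R : realType} {q : nat} (f : 'cV[R]_q) (W : {vspace 'cV[R]_q}).
Local Notation E := (subvs_of W).

Lemma translate_vsval (r : E) : translate f W (f + vsval r).
Proof. by rewrite /translate /= addrC addKr subvsP. Qed.

Lemma translateP x : translate f W x -> exists r : E, x = f + vsval r.
Proof.
by move=> xW; exists (vsproj W (x - f)); rewrite vsprojK// addrC subrK.
Qed.

Lemma relintE (A S : set 'cV[R]_q) y :
  A y -> relint A S y = within A (nbhs y) S.
Proof. by move=> Ay; rewrite (nbhs_subspace_in Ay). Qed.

Lemma relint_functionals t (g : 'I_t -> 'Hom(E, R^o)) (S : set 'cV[R]_q)
    (e : R) (r : E) :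
  0 < e -> (forall w, (forall i, g i w < e) -> S (f + vsval (r + w))) ->
  relint (translate f W) S (f + vsval r).
Proof.
move=> e0 Sw; rewrite relintE; last exact: translate_vsval.
set y := f + vsval r.
have near_lt : \forall x \near y,
    forall i, (functional_row (g i) *m (x - y)) ord0 ord0 < e.
  have FF : Filter (nbhs (y : 'cV[R]_q)) by exact: nbhs_filter.
  apply: (@filter_forall _ _ _ _ FF) => i; pose G := functional_row (g i).
  pose F (x : 'cV[R]_q) : R := \sum_j G ord0 j * (x j ord0 - y j ord0).
  have GE x : (G *m (x - y)) ord0 ord0 = F x.
    rewrite mxE; apply: eq_bigr => j _.
    by rewrite [(x - y) j ord0]mxE [(- y) j ord0]mxE.
  have cont : F x @[x --> y] --> F y.
    apply: cvg_big => [|j _]; first exact: add_continuous.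
    apply: cvgMl_tmp; apply: cvgB; last exact: cvg_cst.
    exact: coord_continuous.
  have Fe : F y < e by rewrite /F big1// => j _; rewrite subrr mulr0.
  apply: (@filterS _ _ FF _ _ _ (@cvgr_lt _ _ _ FF F (F y) cont e Fe)) => x.
  by rewrite /= -GE.
apply: filterS near_lt => x xlt /translateP[r' xE]; rewrite xE.
have -> : r' = r + (r' - r) by rewrite addrC subrK.
apply: Sw => i; have := xlt i.
have -> : x - y = vsval (r' - r).
  by rewrite xE linearB opprD addrACA subrr add0r.
by rewrite functional_row_vsval.
Qed.

(** The path [s |-> f + s *: r] is continuous and stays in [f + W], so it remains in [S] slightly
    beyond [s = 1]. *)
Lemma relint_scale (S : set 'cV[R]_q) (r : E) :
  relint (translate f W) S (f + vsval r) ->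
  exists2 s : R, 1 < s & S (f + vsval (s *: r)).
Proof.
rewrite relintE; last exact: translate_vsval.
move=> nS.
pose F (s : R) : 'cV[R]_q := f + s *: vsval r.
have cont : F s @[s --> (1 : R)] --> F 1.
  by apply: cvgD; [exact: cvg_cst|apply: cvgZr_tmp; exact: cvg_id].
rewrite /F scale1r in cont.
have /nbhs_ballP[e /= e0 be] := cont _ nS.
have := be (1 + e / 2); rewrite /ball /= opprD addNKr normrN.
rewrite gtr0_norm ?divr_gt0//.
rewrite ltr_pdivrMr// ltr_pMr// ltr1n => /(_ isT) h.
exists (1 + e / 2); first by rewrite ltrDl divr_gt0.
by apply: h; exact: (translate_vsval ((1 + e / 2) *: r)).
Qed.

(** In a cover with the fewest functionals, each one has an integral point that no other covers, or
    it could be dropped. The point [r0] excludes the empty cover. *)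
Lemma minimal_cover (p : E -> R) (r0 : E) : sublinear p -> integral_ray f r0 ->
  (forall r : E, integral_ray f r -> 1 <= p r) ->
  exists t (g : 'I_t.+1 -> 'Hom(E, R^o)),
    [/\ forall i x, g i x <= p x,
        forall r : E, integral_ray f r -> exists i, 1 <= g i r
      & forall i, exists r : E,
          integral_ray f r /\ forall j, j != i -> g j r < 1].
Proof.
move=> psub Zr0 p1.
pose Q m := exists g : 'I_m -> 'Hom(E, R^o),
  (forall i x, g i x <= p x) /\
  forall r : E, integral_ray f r -> exists i, 1 <= g i r.
have exQ : exists m, `[< Q m >].
  have [G [Gp Gcov]] := integral_cover psub p1.
  exists #|{ffun 'I_q -> bool}|; apply/asboolP.
  exists (G \o enum_val); split=> [i|r].
    exact: Gp.
  by case/Gcov => d Gd; exists (enum_rank d); rewrite /= enum_rankK.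
case: (ex_minnP exQ) => -[|t] /asboolP[g [gp gcov]] tmin.
  by case: (gcov _ Zr0) => -[].
exists t, g; split=> // i; apply: contrapT => nex.
have /tmin : `[< Q t >]; last by rewrite ltnn.
apply/asboolP; exists (g \o lift i); split=> [j|r Zr]; first exact: gp.
apply: contrapT => /forallNP small; apply: nex; exists r; split=> // j.
rewrite eq_sym => /unlift_some[k -> _]; have /negP := small k.
by rewrite -ltNge.
Qed.

End RelativeInterior.

(** * The polyhedron of the functionals is irredundant and maximal lattice-free *)

Lemma conv_lmodE (R : realType) (V : lmodType R) (k : {i01 R})
    (x y : convex_lmodType V) :
  conv k x y = k%:num *: (x : V) + (1 - k%:num) *: (y : V).
Proof. by []. Qed.

Section Maximality.
Context {R : realType} {q : nat} (f : 'cV[R]_q) (W : {vspace 'cV[R]_q}).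
Local Notation E := (subvs_of W).
Context (t : nat) (g : 'I_t.+1 -> 'Hom(E, R^o)).
Local Notation a := (fun i => functional_row (g i)).

Lemma psiB_functional_row r : psiB a r = \big[Num.max/g ord0 r]_i g i r.
Proof.
rewrite /psiB functional_row_vsval; apply: eq_bigr => i _.
by rewrite functional_row_vsval.
Qed.

Lemma psiB_le r x : (psiB a r <= x) <-> (forall i, g i r <= x).
Proof.
rewrite psiB_functional_row; split=> [h i|h].
  exact: le_trans (le_bigmax _ _ i) h.
by apply: bigmax_le.
Qed.

Lemma functional_le_psiB i r : g i r <= psiB a r.
Proof. by have [+ _] := psiB_le r (psiB a r); apply. Qed.

Lemma psiB_sublinear : sublinear (psiB a : E -> R).
Proof.
split=> [x y|s x s0].
  by apply/psiB_le => i; rewrite linearD lerD// functional_le_psiB.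
apply/le_anti/andP; split.
  by apply/psiB_le => i; rewrite linearZ ler_wpM2l// functional_le_psiB.
have [s00|{}s0] := leP s 0.
  have -> : s = 0 by apply/le_anti; rewrite s00 s0.
  rewrite mul0r scale0r (le_trans _ (functional_le_psiB ord0 0))//.
  by rewrite linear0.
rewrite -ler_pdivlMl//; apply/psiB_le => i; rewrite ler_pdivlMl//.
by have := functional_le_psiB i (s *: x); rewrite linearZ.
Qed.

Lemma polyhedronE (P : pred 'I_t.+1) (r : E) :
  polyhedron f W a P (f + vsval r) <-> (forall i, P i -> g i r <= 1).
Proof.
rewrite /polyhedron /=.
have -> : f + vsval r - f = vsval r by rewrite addrC addKr.
split=> [[_ h] i Pi|h]; first by have := h i Pi; rewrite functional_row_vsval.
split=> [|i Pi]; first exact: translate_vsval.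
by rewrite functional_row_vsval h.
Qed.

Lemma polyhedron_predT (r : E) :
  polyhedron f W a predT (f + vsval r) <-> psiB a r <= 1.
Proof.
split=> [/polyhedronE h|/psiB_le h]; first by apply/psiB_le => i; exact: h.
by apply/polyhedronE => i _.
Qed.

Lemma polyhedron_irredundant :
  (forall r : E, integral_ray f r -> exists i, 1 <= g i r) ->
  (forall i, exists r : E, integral_ray f r /\ forall j, j != i -> g j r < 1) ->
  irredundant_description f W a (polyhedron f W a predT).
Proof.
move=> gcov girr; split=> // i eqB.
have [r [Zr rlt]] := girr i.
have gi1 : 1 <= g i r.
  have [j gj] := gcov r Zr; have [<-//|/rlt] := eqVneq j i.
  by rewrite ltNge gj.
(* Stretching [r] by [m^-1 > 1] keeps every constraint but the [i]-th. The default [2^-1] keeps [m]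
   positive, also when there is no other constraint. *)
pose m := \big[Num.max/(2^-1 : R)]_(j | j != i) g j r.
have m1 : m < 1 by apply: bigmax_lt => //; lra.
have m0 : 0 < m.
  by apply: (@lt_le_trans _ _ 2^-1); [lra|exact: bigmax_ge_id].
have : polyhedron f W a (predC1 i) (f + vsval (m^-1 *: r)).
  apply/polyhedronE => j ji.
  rewrite linearZ /= /GRing.scale/= ler_pdivrMl// mulr1.
  exact: le_bigmax_cond.
rewrite eqB => /polyhedronE/(_ i isT).
by rewrite linearZ /= /GRing.scale/= ler_pdivrMl// mulr1; lra.
Qed.

Lemma relint_polyhedron : relint (translate f W) (polyhedron f W a predT) f.
Proof.
have : relint (translate f W) (polyhedron f W a predT) (f + vsval (0 : E)).
  apply: (relint_functionals (g := g) ltr01) => w gw.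
  by rewrite add0r; apply/polyhedronE => i _; exact: ltW.
by rewrite linear0 addr0.
Qed.

(** An integral point in the interior could be stretched from [f] by some [s > 1] within the
    polyhedron, which forces [psiB] below 1 there. *)
Lemma polyhedron_lattice_free :
  (forall r : E, integral_ray f r -> 1 <= psiB a r) ->
  lattice_free f W (polyhedron f W a predT).
Proof.
move=> M1; have [MD MZ] := psiB_sublinear; split=> [x []//||].
  move=> x y k /set_mem Bx /set_mem By; apply: mem_set.
  have [[/translateP[r1 xE] _] [/translateP[r2 yE] _]] := (Bx, By).
  rewrite xE in Bx; rewrite yE in By; subst x y.
  move/polyhedron_predT: Bx => Bx; move/polyhedron_predT: By => By.
  have -> : conv k (f + vsval r1 : convex_lmodType 'cV[R]_q) (f + vsval r2) =
      f + vsval (k%:num *: r1 + (1 - k%:num) *: r2).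
    transitivity (f + (k%:num *: vsval r1 + (1 - k%:num) *: vsval r2)) => //.
    rewrite conv_lmodE !scalerDr addrACA; congr (_ + _).
    by rewrite -scalerDl addrCA subrr addr0 scale1r.
  have k0 : 0 <= k%:num by [].
  have k1 : 0 <= 1 - k%:num by rewrite subr_ge0.
  apply/polyhedron_predT; apply: (le_trans (MD _ _)); rewrite !MZ//.
  have := ler_wpM2l k0 Bx; have := ler_wpM2l k1 By; lra.
rewrite -subset0 => z [zB Zz].
have /translateP[r zE] : translate f W z by have [] := interior_subset zB.
rewrite zE in zB Zz; have [s s1 /polyhedron_predT] := relint_scale zB.
rewrite MZ; last by lra.
have := M1 r Zz; have : 0 < s by lra.
by move=> s0 /(ler_wpM2l (ltW s0)); lra.
Qed.

(* A larger lattice-free set would contain a point [f + r1] with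
   [psiB r1 > 1], and [psiB] could be lowered to [1] at [r1]. *)
Lemma polyhedron_maximal : (forall r : E, 0 <= psiB a r) ->
  minimal f (psiB a : E -> R) 1 ->
  maximal_lattice_free f W (polyhedron f W a predT).
Proof.
move=> M0 [vM nomin]; have Msub := psiB_sublinear; have [MD MZ] := Msub.
split.
  by apply: polyhedron_lattice_free => r; exact: valid_integral_ray.
move=> B' [B'W B'conv B'free] BB'; apply/seteqP; split=> // x B'x.
have [r1 xE] := translateP (B'W _ B'x); rewrite xE in B'x *.
apply/polyhedron_predT; rewrite leNgt; apply/negP => r1gt.
apply: nomin; exists (fun r => if r == r1 then 1 else psiB a r).
split; last first.
- by move=> r; case: eqVneq => [->|//]; exact: ltW.
- by move/(congr1 (@^~ r1)); rewrite eqxx => eq1; rewrite -eq1 ltxx in r1gt.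
move=> s [s0 Zs]; rewrite /satisfies leNgt; apply/negP.
rewrite weighted_pointE in Zs.
set tau := \sum_(r <- finsupp s | r == r1) s r.
pose u := \sum_(r <- finsupp s | r != r1) s r *: r.
have tau0 : 0 <= tau by apply: sumr_ge0.
have totalE : \sum_(r <- finsupp s) s r *: r = tau *: r1 + u.
  rewrite (bigID (pred1 r1))/=; congr (_ + _).
  by rewrite scaler_suml; apply: eq_bigr => r /eqP ->.
rewrite (bigID (pred1 r1))/=.
under eq_bigr => r -> do rewrite mul1r.
rewrite -/tau; under eq_bigr => r /negPf -> do [].
set v := \sum_(r <- finsupp s | r != r1) _ => lt1.
have uv : psiB a u <= v.
  rewrite /u /v -big_filter -[leRHS]big_filter.
  by apply: (sublinear_sum id Msub) => r _; exact: s0.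
have u0 := M0 u.
have tau1 : 0 < 1 - tau by lra.
(* This is the slack left by the violated inequality. For [w] with [psiB w <= e], [f + b] lies in
   the polyhedron, and [f + tau *: r1 + u + w] is the combination of [f + r1] and [f + b] with
   weights [tau] and [1 - tau]. So the integral point reached by [s] is interior to [B']. *)
pose e := 1 - tau - psiB a u.
have e0 : 0 < e by rewrite /e; lra.
have : relint (translate f W) B' (f + vsval (tau *: r1 + u)).
  apply: (relint_functionals (g := g) e0) => // w gw.
  have we : psiB a w <= e by apply/psiB_le => i; exact: ltW.
  pose b : E := (1 - tau)^-1 *: (u + w).
  have Bb : B' (f + vsval b).
    apply/BB'/polyhedron_predT; rewrite MZ ?invr_ge0 ?(ltW tau1)//.
    rewrite ler_pdivrMl// mulr1 (le_trans (MD _ _))//.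
    by move: we; rewrite /e; lra.
  pose k : {i01 R} := Itv01 tau0 (ltac:(lra) : tau <= 1).
  have := B'conv _ _ k (mem_set B'x) (mem_set Bb); rewrite inE; congr B'.
  rewrite conv_lmodE !scalerDr addrACA -scalerDl (addrC k%:num) subrK scale1r.
  transitivity (f + vsval (tau *: r1 + (1 - tau) *: b)) => //.
  by rewrite /b scalerA mulfV ?(gt_eqF tau1)// scale1r (addrA (tau *: r1)).
rewrite -totalE => Bint.
by have : set0 (f + vsval (\sum_(r <- finsupp s) s r *: r)) by rewrite -B'free.
Qed.

End Maximality.

(** * Domination by minimal inequalities and their polyhedral form *)

Theorem theorem3 (R : realType) (q : nat) (f : 'cV[R]_q)
    (W : {vspace 'cV[R]_q})
    (fWZ : translate f W `&` integral_points !=set0) :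
  (forall (psi : subvs_of W -> R) (alpha : R),
     valid f psi alpha -> nontrivial f psi alpha ->
     exists psi' : subvs_of W -> R,
       [/\ minimal f psi' alpha, nontrivial f psi' alpha
         & dominates psi' psi])
  /\
  (forall (l : nat) (C : 'M[R]_(l, q)) (d : 'cV[R]_l),
     affV f W = [set x | translate f W x /\ C *m x = d] ->
   forall (psi : subvs_of W -> R) (alpha : R),
     minimal f psi alpha -> nontrivial f psi alpha ->
     exists (B : set 'cV[R]_q) (t : nat) (a : 'I_t.+1 -> 'rV[R]_q),
       [/\ maximal_lattice_free f W B,
           relint (translate f W) B f,
           irredundant_description f W a B,
           forall r : subvs_of W, 0 <= psiB a r
         & equivalent f C d psi alpha (psiB a) 1]).
Proof.
have [r0 Zr0] := exists_integral_ray fWZ.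
split=> [psi alpha vpsi ntriv|l C d VE psi alpha mpsi ntriv].
  have [psi' [mpsi' dom]] := minimal_below Zr0 vpsi.
  by exists psi'; split=> //; exact: nontrivial_dominates dom ntriv.
have [phi [rho [lambda [mphi phi0 rho0 psiE alphaE]]]] :=
  normalize VE Zr0 mpsi ntriv.
have [vphi nomin] := mphi.
have phi1 (r : subvs_of W) : integral_ray f r -> 1 <= phi r.
  exact: valid_integral_ray.
have [t [g [gphi gcov girr]]] :=
  minimal_cover (minimal_sublinear mphi) Zr0 phi1.
pose a i := functional_row (g i).
have psiB_ge1 (r : subvs_of W) : integral_ray f r -> 1 <= psiB a r.
  by case/gcov => i gi; exact: le_trans gi (functional_le_psiB g i r).
have psiB_valid : valid f (psiB a : subvs_of W -> R) 1.
  exact: sublinear_valid (psiB_sublinear g) psiB_ge1.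
have phiE : phi = psiB a.
  apply: contrapT => neq; apply: nomin; exists (psiB a); split=> //.
    by move=> eq; exact: neq.
  by move=> r; apply/psiB_le => i; exact: gphi.
rewrite phiE in mphi phi0 psiE.
exists (polyhedron f W a predT), t, a; split=> //.
- exact: polyhedron_maximal.
- exact: relint_polyhedron.
- exact: polyhedron_irredundant.
- by split=> //; [case: mpsi|exists rho, lambda].
Qed.
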